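(* Let $L$ be a frame and let $(X,r)$ be a $\Phi_L$-algebra over $L\text{-}\mathbf{Top}_0$ for the monad $(\Phi_L,\eta,\mu)$. Equip $X$ with the specialization $L$-order $e$ of its $L$-valued topology $\mathcal{O}(X)$. Then $(X,e)$ is an $L$-valued continuous lattice, and $r(u)=\sqcup u^l$ for every $u\in\Phi_L(X)$, where $u^l(x)=\bigvee_{A\in\mathcal{O}(X)}u(A)\wedge A^l(x)$ for $x\in X$.
   Context: $L$ is a fixed frame (complete Heyting algebra) with implication $a\rightarrow b=\bigvee\{c\mid a\wedge c\le b\}$. An $L$-subset of a set $X$ is a map $X\to L$; $L^X$ carries pointwise order and operations; $a_X$ is the constant map with value $a$. For $f:X\to Y$ and $B\in L^Y$, $f_L^\leftarrow(B)=B\circ f$. Topology. An $L$-valued topology on $X$ is a family $\mathcal{O}(X)\subseteq L^X$ closed under binary meets and arbitrary joins and containing all $a_X$, $a\in L$. It is $T_0$ if $A(x)=A(y)$ for all $A\in\mathcal{O}(X)$ implies $x=y$. A map $f:X\to Y$ is continuous if $f_L^\leftarrow(B)\in\mathcal{O}(X)$ for all $B\in\mathcal{O}(Y)$. $L\text{-}\mathbf{Top}_0$ is the category of $T_0$ $L$-valued topological spaces and continuous maps. The specialization $L$-order of a $T_0$ space is $e(x,y)=\bigwedge_{A\in\mathcal{O}(X)}(A(x)\rightarrow A(y))$. Monad. An open filter of $X$ is a map $u:\mathcal{O}(X)\to L$ with $u(A\wedge B)=u(A)\wedge u(B)$ and $u(a_X)\ge a$ for all $A,B\in\mathcal{O}(X)$,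 $a\in L$. $\Phi_L(X)$ is the set of open filters; for $A\in\mathcal{O}(X)$, $\phi(A)(u)=u(A)$; $\Phi_L(X)$ carries the $L$-valued topology consisting of all joins $\bigvee_j\phi(A_j)\wedge(a_j)_{\Phi_L(X)}$ with $A_j\in\mathcal{O}(X)$, $a_j\in L$. For continuous $f:X\to Y$, $(\Phi_Lf)(u)(B)=u(f_L^\leftarrow(B))$. $\eta_X(x)=[x]$ with $[x](B)=B(x)$; $\mu_X:\Phi_L(\Phi_L(X))\to\Phi_L(X)$ is $\mu_X(\alpha)(A)=\alpha(\phi(A))$. $(\Phi_L,\eta,\mu)$ is a monad on $L\text{-}\mathbf{Top}_0$; a $\Phi_L$-algebra is a pair $(X,r)$ with $X$ an object of $L\text{-}\mathbf{Top}_0$ and $r:\Phi_L(X)\to X$ a continuous map with $r\circ\Phi_Lr=r\circ\mu_X$ and $r\circ\eta_X=\mathrm{id}_X$. $L$-orders. An $L$-order on $X$ is $e:X\times X\to L$ with $e(x,x)=1$; $e(x,y)\wedge e(y,z)\le e(x,z)$; and $e(x,y)\wedge e(y,x)=1$ implies $x=y$. For $A\in L^X$: $A^l(x)=\bigwedge_{y}(A(y)\rightarrow e(x,y))$. An element $x$ is the supremum $\sqcup A$ if $e(x,y)=\bigwedge_{z}(A(z)\rightarrow e(z,y))$ for all $y$. $(X,e)$ is complete if every $L$-subset has a supremum. An ideal is $I\in L^X$ with $\bigvee_xI(x)=1$, $I(x)\wedge I(y)\le\bigvee_zI(z)\wedge e(x,z)\wedge e(y,z)$, and $I(x)\wedge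 e(y,x)\le I(y)$ for all $x,y$; $\mathcal{I}_L(X)$ is the set of ideals. For complete $X$, ${\Downarrow}x(y)=\bigwedge_{I\in\mathcal{I}_L(X)}(e(x,\sqcup I)\rightarrow I(y))$; $X$ is an $L$-valued continuous lattice if it is complete and $\sqcup{\Downarrow}x=x$ for all $x\in X$. *)

(* Defs.v *)
From HB Require Import structures.
From mathcomp Require Import all_boot all_order.
From mathcomp Require Import boolp classical_sets.

Set Implicit Arguments.
Unset Strict Implicit.
Unset Printing Implicit Defensive.

Import Order.TTheory.
Local Open Scope order_scope.

(* A frame: a lattice with joins of arbitrary subsets over which binary meets
   distribute. Starting from a bounded distributive lattice loses nothing,
   since both the bounds and finite distributivity follow from the axioms. *)
HB.mixin Record TBDistrLattice_isFrame d L of Order.TBDistrLattice d L := {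
  bigsup : set L -> L;
  bigsup_ub : forall (S : set L) (a : L), S a -> a <= bigsup S;
  bigsup_le : forall (S : set L) (b : L),
    (forall a, S a -> a <= b) -> bigsup S <= b;
  meet_bigsup : forall (a : L) (S : set L),
    a `&` bigsup S = bigsup [set (a `&` s)%O | s in S]%classic
}.

#[short(type="frameType")]
HB.structure Definition Frame d :=
  { L of TBDistrLattice_isFrame d L & Order.TBDistrLattice d L }.

Section FrameOps.
Context {d : Order.disp_t} {L : frameType d}.

Definition biginf (S : set L) : L :=
  bigsup [set c | forall s, S s -> (c <= s)%O]%classic.

Definition himp (a b : L) : L := bigsup [set c | (a `&` c <= b)%O]%classic.

End FrameOps.

Notation "\Vee_ ( i : I ) F" :=
  (bigsup (range (fun i : I => F%O)))
  (at level 41, i at level 50, I at level 200, F at level 41) : order_scope.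
Notation "\Wedge_ ( i : I ) F" :=
  (biginf (range (fun i : I => F%O)))
  (at level 41, i at level 50, I at level 200, F at level 41) : order_scope.
Notation "a =>> b" := (himp a b) (at level 55, right associativity)
  : order_scope.

Section FrameTheory.
Context {d : Order.disp_t} {L : frameType d}.
Implicit Types (a b c : L) (I : Type).

Lemma vee_ub I (F : I -> L) i : F i <= \Vee_(j : I) F j.
Proof. by apply: bigsup_ub; exists i. Qed.

Lemma vee_le I (F : I -> L) b : (forall i, F i <= b) -> \Vee_(i : I) F i <= b.
Proof. by move=> h; apply: bigsup_le => _ [i _ <-]. Qed.

Lemma meet_vee I a (F : I -> L) :
  a `&` (\Vee_(i : I) F i) = \Vee_(i : I) (a `&` F i).
Proof.
rewrite meet_bigsup; congr bigsup; apply/seteqP; split.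
  by move=> _ [_ [i _ <-] <-]; exists i.
by move=> _ [i _ <-]; exists (F i) => //; exists i.
Qed.

Lemma wedge_lb I (F : I -> L) i : \Wedge_(j : I) F j <= F i.
Proof. by apply: bigsup_le => c /(_ (F i)); apply; exists i. Qed.

Lemma wedge_ge I (F : I -> L) b :
  (forall i, b <= F i) -> b <= \Wedge_(i : I) F i.
Proof. by move=> h; apply: bigsup_ub => _ [i _ <-]. Qed.

Lemma le_himp a b c : (c <= a =>> b) = (a `&` c <= b).
Proof.
apply/idP/idP => [h|h]; last exact: bigsup_ub.
apply: le_trans (leI2 (lexx a) h) _; rewrite /himp meet_bigsup.
by apply: bigsup_le => _ [e he <-].
Qed.

End FrameTheory.

(* Objects of L-Top_0. *)
Record LTop0 {d : Order.disp_t} (L : frameType d) := MkLTop0 {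
  pt :> Type;
  opens : set (pt -> L);
  opensI : forall A B, opens A -> opens B -> opens (fun x => A x `&` B x);
  opens_sup : forall S : set (pt -> L),
    (S `<=` opens)%classic -> opens (fun x => bigsup [set A x | A in S]%classic);
  opens_const : forall a : L, opens (fun=> a);
  opens_T0 : forall x y, (forall A, opens A -> A x = A y) -> x = y
}.

Record open {d : Order.disp_t} {L : frameType d} (X : LTop0 L) := Open {
  open_fun :> X -> L;
  openP : opens open_fun
}.

Lemma open_eq d (L : frameType d) (X : LTop0 L) (A B : open X) :
  (forall x, A x = B x) -> A = B.
Proof.
case: A B => [A hA] [B hB] /= h; have eAB : A = B by exact/funext.
by subst B; congr Open; exact: Prop_irrelevance.
Qed.

Definition openI {d : Order.disp_t} {L : frameType d} {X : LTop0 L}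
  (A B : open X) : open X := Open (opensI (openP A) (openP B)).

Definition open_const {d : Order.disp_t} {L : frameType d} (X : LTop0 L)
  (a : L) : open X := Open (opens_const X a).

(* Morphisms of L-Top_0. *)
Record cmap {d : Order.disp_t} {L : frameType d} (X Y : LTop0 L) := CMap {
  cmap_fun :> X -> Y;
  cmap_cont : forall B : Y -> L, opens B -> opens (fun x => B (cmap_fun x))
}.

Definition preim {d : Order.disp_t} {L : frameType d} {X Y : LTop0 L}
  (f : cmap X Y) (B : open Y) : open X := Open (cmap_cont f (openP B)).

Section OpenFilterMonad.
Context {d : Order.disp_t} {L : frameType d}.

(* No condition u(0) = 0 is imposed: a filter need not be proper. *)
Record open_filter (X : LTop0 L) := OpenFilter {
  of_fun :> open X -> L;
  of_meet : forall A B, of_fun (openI A B) = of_fun A `&` of_fun B;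
  of_const : forall a, a <= of_fun (open_const X a)
}.

Lemma open_filter_eq (X : LTop0 L) (u v : open_filter X) :
  (forall A, u A = v A) -> u = v.
Proof.
case: u v => [u u1 u2] [v v1 v2] /= h; have e : u = v by exact/funext.
by subst v; congr OpenFilter; exact: Prop_irrelevance.
Qed.

Definition phi {X : LTop0 L} (A : open X) (u : open_filter X) : L := u A.

(* All joins, over arbitrary index types, of phi(A_j) /\ (a_j constant). *)
Definition Phi_opens (X : LTop0 L) : set (open_filter X -> L) :=
  [set W | exists (J : Type) (A : J -> open X) (a : J -> L),
     W = fun u => (\Vee_(j : J) (phi (A j) u `&` a j))%O]%classic.

Section PhiObj.
Variable X : LTop0 L.

Lemma Phi_opensI (V W : open_filter X -> L) :
  Phi_opens V -> Phi_opens W -> Phi_opens (fun u => V u `&` W u).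
Proof.
move=> [J [A [a ->]]] [K [B [b ->]]].
exists (J * K)%type, (fun p => openI (A p.1) (B p.2)), (fun p => a p.1 `&` b p.2).
apply/funext => u; rewrite meet_vee; apply/le_anti/andP; split.
  apply: vee_le => k; rewrite meetC meet_vee; apply: vee_le => j.
  apply: le_trans (vee_ub _ (j, k)); rewrite /= /phi of_meet.
  by rewrite meetC meetACA.
apply: vee_le => -[j k] /=; apply: le_trans (vee_ub _ k).
rewrite /phi of_meet meetACA; apply: leI2 => //.
exact: (vee_ub (fun j => u (A j) `&` a j) j).
Qed.

Lemma Phi_opens_sup (S : set (open_filter X -> L)) :
  (S `<=` @Phi_opens X)%classic ->
  Phi_opens (fun u => bigsup [set V u | V in S]%classic).
Proof.
move=> hS; set W := fun u => _.
pose J := {p : open X * L | forall u, phi p.1 u `&` p.2 <= W u}.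
exists J, (fun j => (sval j).1), (fun j => (sval j).2).
apply/funext => u; apply/le_anti/andP; split; last first.
  by apply: vee_le => -[p hp] /=; exact: hp.
apply: bigsup_le => _ [V SV <-].
have [K [A [a eV]]] := hS V SV; rewrite {1}eV; apply: vee_le => k.
have hk v : phi (A k) v `&` a k <= W v.
  apply: (@le_trans _ _ (V v)); last by apply: bigsup_ub; exists V.
  rewrite eV; exact: (vee_ub (fun k => phi (A k) v `&` a k) k).
exact: (vee_ub (fun j : J => phi (sval j).1 u `&` (sval j).2)
         (exist _ (A k, a k) hk)).
Qed.

Lemma phi_meet_open (A : open X) (a : L) :
  Phi_opens (fun u => phi A u `&` a).
Proof.
exists unit, (fun=> A), (fun=> a); apply/funext => u.
apply/le_anti/andP; split; last exact: vee_le.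
exact: (vee_ub (fun _ : unit => phi A u `&` a) tt).
Qed.

Lemma Phi_opens_const (a : L) : Phi_opens (fun _ : open_filter X => a).
Proof.
have -> : (fun _ : open_filter X => a)
          = (fun u => phi (open_const X \top) u `&` a).
  apply/funext => u; have := of_const u \top.
  by rewrite le1x => /eqP h; rewrite /phi h meet1x.
exact: phi_meet_open.
Qed.

Lemma phi_open (A : open X) : Phi_opens (phi A).
Proof.
have -> : phi A = (fun u => phi A u `&` \top).
  by apply/funext => u; rewrite meetx1.
exact: phi_meet_open.
Qed.

Lemma Phi_opens_T0 (u v : open_filter X) :
  (forall W, Phi_opens W -> W u = W v) -> u = v.
Proof.
by move=> h; apply: open_filter_eq => A; exact: (h _ (phi_open A)).
Qed.

Definition Phi : LTop0 L :=
  MkLTop0 Phi_opensI Phi_opens_sup Phi_opens_const Phi_opens_T0.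

Definition phiO (A : open X) : open Phi := @Open _ _ Phi (phi A) (phi_open A).

End PhiObj.

Lemma opens_vee (X : LTop0 L) (J : Type) (A : J -> X -> L) :
  (forall j, opens (A j)) -> opens (fun x => \Vee_(j : J) A j x).
Proof.
move=> h; have := @opens_sup _ _ X (range A).
have -> : (fun x => bigsup [set B x | B in range A]%classic)
          = (fun x => \Vee_(j : J) A j x).
  apply/funext => x; congr bigsup; apply/seteqP; split.
    by move=> _ [_ [j _ <-] <-]; exists j.
  by move=> _ [j _ <-]; exists (A j) => //; exists j.
by apply => _ [j _ <-].
Qed.

(* The sets phi A generate the topology, so they suffice for continuity. *)
Lemma cont_Phi (X Y : LTop0 L) (f : X -> Phi Y) :
  (forall B : open Y, opens (fun x => f x B)) ->
  forall W : Phi Y -> L, opens W -> opens (fun x => W (f x)).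
Proof.
move=> h _ [J [A [a ->]]]; apply: opens_vee => j.
by apply: opensI; [exact: h | exact: opens_const].
Qed.

Section PhiMap.
Context {X Y : LTop0 L} (f : cmap X Y).

Definition Phi_map_fun (u : Phi X) : Phi Y.
Proof.
exists (fun B => u (preim f B)).
- by move=> A B; rewrite -of_meet; congr (of_fun u _); apply: open_eq.
- move=> a; apply: le_trans (of_const u a) _.
  by rewrite le_eqVlt; apply/orP/or_introl/eqP; congr (of_fun u _); apply: open_eq.
Defined.

Lemma Phi_map_cont (W : Phi Y -> L) :
  opens W -> opens (fun u => W (Phi_map_fun u)).
Proof. by apply: cont_Phi => B; exact: (phi_open (preim f B)). Qed.

Definition Phi_map : cmap (Phi X) (Phi Y) := CMap Phi_map_cont.

End PhiMap.

Section Unit.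
Variable X : LTop0 L.

Definition eta_fun (x : X) : Phi X :=
  @OpenFilter X (fun B => B x) (fun _ _ => erefl) (fun a => lexx a).

Lemma eta_cont (W : Phi X -> L) : opens W -> opens (fun x => W (eta_fun x)).
Proof. by apply: cont_Phi => B; exact: openP. Qed.

Definition eta : cmap X (Phi X) := CMap eta_cont.

End Unit.

Section Mult.
Variable X : LTop0 L.

Definition mu_fun (alpha : Phi (Phi X)) : Phi X.
Proof.
exists (fun A => alpha (phiO A)).
- move=> A B; rewrite -of_meet; congr (of_fun alpha _); apply: open_eq => u.
  exact: of_meet.
- move=> a; apply: le_trans (of_const alpha a) _.
  rewrite leEmeet -of_meet; apply/eqP; congr (of_fun alpha _).
  by apply: open_eq => u; apply/eqP; rewrite -leEmeet; exact: of_const.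
Defined.

Lemma mu_cont (W : Phi X -> L) : opens W -> opens (fun u => W (mu_fun u)).
Proof. by apply: cont_Phi => B; exact: (phi_open (phiO B)). Qed.

Definition mu : cmap (Phi (Phi X)) (Phi X) := CMap mu_cont.

End Mult.

Record is_Phi_algebra (X : LTop0 L) (r : cmap (Phi X) X) : Prop := {
  alg_assoc : r \o Phi_map r = r \o mu X;
  alg_unit : r \o eta X = id
}.

End OpenFilterMonad.

Section LOrders.
Context {d : Order.disp_t} {L : frameType d}.

Record Lposet := MkLposet {
  lcar :> Type;
  lord : lcar -> lcar -> L;
  lord_refl : forall x, lord x x = \top;
  lord_trans : forall x y z, lord x y `&` lord y z <= lord x z;
  lord_anti : forall x y, lord x y `&` lord y x = \top -> x = y
}.

(* A^l, the L-subset of lower bounds of A. *)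
Definition lower (P : Lposet) (A : P -> L) (x : P) : L :=
  \Wedge_(y : P) (A y =>> lord x y).

Definition is_lsup (P : Lposet) (A : P -> L) (x : P) : Prop :=
  forall y, lord x y = \Wedge_(z : P) (A z =>> lord z y).

Definition lcomplete (P : Lposet) : Prop :=
  forall A : P -> L, exists x, is_lsup A x.

(* The supremum is unique by antisymmetry, so the choice is immaterial. *)
Definition lsup (P : Lposet) (cP : lcomplete P) (A : P -> L) : P :=
  sval (cid (cP A)).

Record ideal (P : Lposet) := Ideal {
  ideal_fun :> P -> L;
  ideal_inh : \Vee_(x : P) ideal_fun x = \top;
  ideal_dir : forall x y, ideal_fun x `&` ideal_fun y <=
    \Vee_(z : P) (ideal_fun z `&` lord x z `&` lord y z);
  ideal_down : forall x y, ideal_fun x `&` lord y x <= ideal_fun y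
}.

Definition waybelow (P : Lposet) (cP : lcomplete P) (x y : P) : L :=
  \Wedge_(I : ideal P) (lord x (lsup cP I) =>> I y).

Definition continuous_lattice (P : Lposet) : Prop :=
  exists cP : lcomplete P, forall x : P, lsup cP (waybelow cP x) = x.

End LOrders.

Section Specialization.
Context {d : Order.disp_t} {L : frameType d} (X : LTop0 L).

Definition spec (x y : X) : L := \Wedge_(A : open X) (A x =>> A y).

Lemma spec_refl x : spec x x = \top.
Proof.
by apply/le_anti; rewrite lex1 wedge_ge // => A; rewrite le_himp leIl.
Qed.

Lemma spec_open (A : open X) x y : A x `&` spec x y <= A y.
Proof. by rewrite -le_himp; exact: (wedge_lb (fun A : open X => A x =>> A y)). Qed.

Lemma spec_trans x y z : spec x y `&` spec y z <= spec x z.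
Proof.
apply: wedge_ge => A; rewrite le_himp meetA.
exact: le_trans (leI2 (spec_open A x y) (lexx _)) (spec_open A y z).
Qed.

Lemma spec_anti x y : spec x y `&` spec y x = \top -> x = y.
Proof.
move=> h; have := lexx (\top : L); rewrite -{2}h lexI !le1x.
move=> /andP[/eqP hxy /eqP hyx]; apply: opens_T0 => A oA; apply/le_anti.
by have := spec_open (Open oA) x y; have := spec_open (Open oA) y x;
  rewrite hxy hyx /= !meetx1 => -> ->.
Qed.

Definition spec_order : Lposet := MkLposet spec_refl spec_trans spec_anti.

(* u^l, the join over open A of u(A) /\ A^l. *)
Definition filter_lower (u : Phi X) (x : spec_order) : L :=
  \Vee_(A : open X) (u A `&` lower (P := spec_order) A x).

End Specialization.

(* Main.v *)
Require Import Defs.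
From mathcomp Require Import all_boot all_order.
From mathcomp Require Import boolp classical_sets.

Set Implicit Arguments.
Unset Strict Implicit.
Unset Printing Implicit Defensive.

Import Order.TTheory.
Local Open Scope order_scope.

(** The unit law makes the structure map [r] right adjoint to the unit:
    [e(x, r u)] is the degree to which the point filter of [x] is contained in
    [u].  Hence [r], applied to the filter of opens containing an L-subset [A],
    yields the infimum of [A], so X is complete.  Expanding [B o r] in the basis
    of Phi X and testing it on the filters generated by opens shows
    [r u = sup u^l].  Finally, an ideal [I] generates the open filter
    [B |-> \Vee_z (I z /\ B z)], whose image under [r] bounds [I]; so opens are
    Scott open, the way-below ideal of [x] is [ [x]^l ], and its supremum is
    [r [x] = x]. *)

Ltac le_factor :=
  first [ exact: lexx
        | apply: le_trans (leIl _ _) _; le_factor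
        | apply: le_trans (leIr _ _) _; le_factor ].
Ltac le_meets := rewrite ?lexI; repeat (apply/andP; split); le_factor.

(** * Joins and implication in a frame *)

Section FrameLemmas.
Context {d : Order.disp_t} {L : frameType d}.
Implicit Types (a b c : L) (I J : Type).

Lemma vee_meet I a (F : I -> L) :
  (\Vee_(i : I) F i) `&` a = \Vee_(i : I) (F i `&` a).
Proof.
rewrite meetC meet_vee; congr bigsup; apply/seteqP.
by split=> _ [i _ <-]; exists i; rewrite // meetC.
Qed.

Lemma wedge_mp I (F G : I -> L) i : F i `&` (\Wedge_(j : I) (F j =>> G j)) <= G i.
Proof. by rewrite -le_himp; exact: (wedge_lb (fun j => F j =>> G j)). Qed.

End FrameLemmas.

(** * Suprema from infima in an L-order *)

Section LposetLemmas.
Context {d : Order.disp_t} {L : frameType d} {P : @Lposet d L}.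
Implicit Types (A : P -> L) (x y z : P).

Definition upper A y : L := \Wedge_(z : P) (A z =>> lord z y).

Definition is_linf A x : Prop := forall y, lord y x = lower A y.

Lemma lower_linf A x : is_linf A x -> lower A x = \top.
Proof. by move=> /(_ x) <-; exact: lord_refl. Qed.

(** Each [z] is a lower bound of [upper A] at least to degree [A z], hence lies below [x] to that
    degree; conversely, [x] is itself a lower bound of [upper A] to degree [\top]. *)
Lemma linf_upper_is_lsup A x : is_linf (upper A) x -> is_lsup A x.
Proof.
move=> hx y; apply/le_anti/andP; split.
  apply: wedge_ge => z; rewrite le_himp.
  have Ax : A z <= lord z x.
    by rewrite hx; apply: wedge_ge => w; rewrite le_himp meetC; exact: wedge_mp.
  exact: le_trans (leI2 Ax (lexx _)) (lord_trans _ _ _).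
have := wedge_mp (upper A) (lord x) y.
by rewrite -[X in _ `&` X]/(lower (upper A) x) lower_linf // meetx1.
Qed.

Lemma lcomplete_linf : (forall A, exists x, is_linf A x) -> lcomplete P.
Proof.
by move=> h A; have [x hx] := h (upper A); exists x; exact: linf_upper_is_lsup.
Qed.

Lemma lsupP (cP : lcomplete P) A : is_lsup A (lsup cP A).
Proof. exact: svalP (cid (cP A)). Qed.

Lemma lsup_unique A x y : is_lsup A x -> is_lsup A y -> x = y.
Proof.
move=> hx hy; have exy : lord x y = \top by rewrite hx -hy lord_refl.
have eyx : lord y x = \top by rewrite hy -hx lord_refl.
by apply: lord_anti; rewrite exy eyx meetx1.
Qed.

End LposetLemmas.

(** * Open filters generated by L-subsets and by ideals *)

Section OpenFilters.
Context {d : Order.disp_t} {L : frameType d} {X : LTop0 L}.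
Implicit Types (A B : open X) (u v : Phi X) (x y z : X).

(** Since [u] dominates constants, the constant [a] can be absorbed into the argument of [u];
    preservation of meets then gives monotonicity. *)
Lemma open_filter_sub u A B a :
  (forall x, A x `&` a <= B x) -> u A `&` a <= u B.
Proof.
move=> h; apply: le_trans (leI2 (lexx _) (of_const u a)) _.
rewrite -of_meet.
have -> : openI A (open_const X a) = openI (openI A (open_const X a)) B.
  by apply: open_eq => x /=; apply/esym/meet_l; exact: h.
by rewrite [X in X <= _]of_meet leIr.
Qed.

Lemma open_filter_top u : u (open_const X \top) = \top.
Proof. by apply/le_anti; rewrite lex1 of_const. Qed.

Definition subset_degree (A B : X -> L) : L := \Wedge_(x : X) (A x =>> B x).

Definition up_filter (A : X -> L) : Phi X.
Proof.
exists (fun B => subset_degree A B).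
- move=> B C; apply/le_anti/andP; split.
    rewrite lexI; apply/andP; split; apply: wedge_ge => x; rewrite le_himp;
      apply: le_trans (wedge_mp _ _ _) _; [exact: leIl | exact: leIr].
  apply: wedge_ge => x; rewrite le_himp lexI; apply/andP; split.
    by apply: le_trans (wedge_mp A B x); le_meets.
  by apply: le_trans (wedge_mp A C x); le_meets.
- by move=> a; apply: wedge_ge => x; rewrite le_himp leIr.
Defined.

Lemma up_filter_self A : up_filter A A = \top.
Proof. by apply/le_anti; rewrite lex1 wedge_ge // => x; rewrite le_himp leIl. Qed.

Definition ideal_filter (I : ideal (spec_order X)) : Phi X.
Proof.
exists (fun B => \Vee_(z : X) (I z `&` B z)).
- move=> B C; apply/le_anti/andP; split.
    apply: vee_le => z; rewrite lexI; apply/andP; split.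
      by apply: le_trans (vee_ub _ z); le_meets.
    by apply: le_trans (vee_ub _ z); le_meets.
  rewrite vee_meet; apply: vee_le => x; rewrite meet_vee; apply: vee_le => y.
  (* Directedness replaces the witnesses [x] and [y] by one [z] above both, and opens are upward
     closed for the specialization order. *)
  rewrite meetACA; apply: le_trans (leI2 (ideal_dir I x y) (lexx _)) _.
  rewrite vee_meet; apply: vee_le => z; apply: le_trans (vee_ub _ z) => /=.
  rewrite !lexI; apply/andP; split; first le_factor.
  apply/andP; split.
    by apply: le_trans (spec_open B x z); le_meets.
  by apply: le_trans (spec_open C y z); le_meets.
- by move=> a; rewrite -{1}[a]meet1x -(ideal_inh I) -vee_meet; exact: lexx.
Defined.

Lemma open_meet_lower A B x y :
  A y `&` (lower (P := spec_order X) A x `&` B x) <= B y.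
Proof.
apply: le_trans (spec_open B x y); rewrite lexI; apply/andP; split; first le_factor.
by apply: le_trans (wedge_mp (A : spec_order X -> L) (@lord _ _ (spec_order X) x) y);
  le_meets.
Qed.

End OpenFilters.

(** * Infima, suprema and opens of an algebra *)

Section Algebra.
Context {d : Order.disp_t} {L : frameType d} {X : LTop0 L}.
Variables (r : cmap (Phi X) X) (rP : is_Phi_algebra r).
Local Notation P := (spec_order X).

Lemma alg_point x : r (eta X x) = x.
Proof. by have := congr1 (fun f : X -> X => f x) (alg_unit rP). Qed.

Lemma open_alg_basis (B : open X) :
  exists (J : Type) (A : J -> open X) (a : J -> L),
    forall v, B (r v) = \Vee_(j : J) (v (A j) `&` a j).
Proof.
have [J [A [a eB]]] := cmap_cont r (openP B).
by exists J, A, a => v; exact: (congr1 (fun W : Phi X -> L => W v) eB).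
Qed.

(** Evaluating the expansion of [B] at point filters, where [r [x] = x], bounds each term
    [A j x /\ a j] by [B x]; [open_filter_sub] transfers this bound to [u]. *)
Lemma open_alg_le (B : open X) u : B (r u) <= u B.
Proof.
have [J [A [a eB]]] := open_alg_basis B.
rewrite eB; apply: vee_le => j; apply: open_filter_sub => x.
rewrite -{2}(alg_point x) eB.
exact: (vee_ub (fun j => A j x `&` a j)).
Qed.

Lemma spec_alg (x : X) u : spec x (r u) = \Wedge_(B : open X) (B x =>> u B).
Proof.
apply/le_anti/andP; split; apply: wedge_ge => B; rewrite le_himp.
  exact: le_trans (spec_open B x (r u)) (open_alg_le B u).
have [J [A [a eB]]] := open_alg_basis B.
(* With [x] written as [r [x]], both [B x] and [B (r u)] expand over the same opens [A j]. *)
rewrite -{1}(alg_point x) !eB vee_meet; apply: vee_le => j.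
apply: le_trans (vee_ub _ j); rewrite lexI; apply/andP; split; last le_factor.
apply: le_trans (wedge_mp (fun B : open X => B x) u (A j)).
rewrite lexI; apply/andP; split; last le_factor.
by apply: le_trans (leIl _ _) _; exact: leIl.
Qed.

(** By [spec_alg], both sides amount to the meet over [x] and [B] of [A x /\ B y =>> B x], taken in
    the two orders. *)
Lemma alg_linf (A : X -> L) : is_linf (P := P) A (r (up_filter A)).
Proof.
move=> y; rewrite /= spec_alg; apply/le_anti/andP; split.
  apply: wedge_ge => x; rewrite le_himp; apply: wedge_ge => B; rewrite le_himp.
  apply: le_trans (wedge_mp A B x).
  rewrite lexI; apply/andP; split; first le_factor.
  by apply: le_trans (wedge_mp (fun B : open X => B y) (up_filter A) B); le_meets.
apply: wedge_ge => B; rewrite le_himp; apply: wedge_ge => x; rewrite le_himp.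
apply: le_trans (spec_open B y x); rewrite lexI; apply/andP; split; first le_factor.
by apply: le_trans (wedge_mp A (@lord _ _ P y) x); le_meets.
Qed.

Lemma alg_lcomplete : lcomplete P.
Proof. by apply: lcomplete_linf => A; exists (r (up_filter A)); exact: alg_linf. Qed.

Lemma filter_le_lower_linf (u : Phi X) (A : open X) : u A <= filter_lower u (r (up_filter A)).
Proof.
apply: le_trans (vee_ub _ A).
by rewrite (lower_linf (alg_linf A)) meetx1.
Qed.

(** If [x] is a lower bound of [A] and lies in [B], then [A] is contained in [B], so [u A] passes to
    [u B]. *)
Lemma filter_lower_le_alg u x : filter_lower u x <= spec x (r u).
Proof.
rewrite spec_alg; apply: vee_le => A; apply: wedge_ge => B; rewrite le_himp.
rewrite meetC -meetA; apply: open_filter_sub => y; exact: open_meet_lower.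
Qed.

Lemma alg_lsup u : is_lsup (P := P) (filter_lower u) (r u).
Proof.
move=> y; apply/le_anti/andP; split.
  apply: wedge_ge => z; rewrite le_himp /=.
  exact: le_trans (leI2 (filter_lower_le_alg u z) (lexx _)) (spec_trans _ _ _).
apply: wedge_ge => B; rewrite le_himp.
have [J [A [a eB]]] := open_alg_basis B.
rewrite {1}eB vee_meet; apply: vee_le => j.
(* The infimum of [A j] is the test point: [filter_lower u] holds there to degree at least
   [u (A j)], and [B] to degree at least [a j]. *)
set i := r (up_filter (A j)).
have aB : a j <= B i.
  by rewrite eB; apply: le_trans (vee_ub _ j); rewrite up_filter_self meet1x.
apply: le_trans (spec_open B i y); rewrite lexI; apply/andP; split.
  by apply: le_trans aB; le_factor.
apply: le_trans (wedge_mp (filter_lower u) (fun z => @lord _ _ P z y) i).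
rewrite lexI; apply/andP; split; last le_factor.
by apply: le_trans (filter_le_lower_linf u (A j)); le_factor.
Qed.

(** * Ideals, Scott openness and the way-below relation *)

Definition filter_lower_ideal (u : Phi X) : ideal P.
Proof.
exists (filter_lower u).
- apply/le_anti; rewrite lex1 /=.
  apply: le_trans (vee_ub _ (r (up_filter (open_const X \top)))).
  by rewrite -{1}(open_filter_top u) filter_le_lower_linf.
- move=> x y; rewrite {1 2}/filter_lower vee_meet; apply: vee_le => A.
  rewrite meet_vee; apply: vee_le => B.
  (* Lower bounds of [A] and of [B] are lower bounds of their meet, so its infimum is above both [x]
     and [y]. *)
  apply: le_trans (vee_ub _ (r (up_filter (openI A B)))).
  have linfAB := alg_linf (openI A B).
  rewrite !linfAB !lexI; apply/andP; split; first (apply/andP; split).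
  + apply: le_trans (filter_le_lower_linf u (openI A B)).
    by rewrite of_meet; le_meets.
  + apply: wedge_ge => z; rewrite le_himp.
    apply: le_trans (wedge_mp (A : P -> L) (@lord _ _ P x) z).
    by rewrite lexI; apply/andP; split; [apply: le_trans (leIl _ _) _; exact: leIl|le_factor].
  + apply: wedge_ge => z; rewrite le_himp.
    apply: le_trans (wedge_mp (B : P -> L) (@lord _ _ P y) z).
    by rewrite lexI; apply/andP; split; [apply: le_trans (leIl _ _) _; exact: leIr|le_factor].
- move=> x y; rewrite {1}/filter_lower vee_meet; apply: vee_le => A.
  apply: le_trans (vee_ub _ A); rewrite lexI; apply/andP; split; first le_factor.
  apply: wedge_ge => z; rewrite le_himp.
  apply: le_trans (lord_trans y x z); rewrite lexI; apply/andP; split; first le_factor.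
  by apply: le_trans (wedge_mp (A : P -> L) (@lord _ _ P x) z); le_meets.
Defined.

Lemma open_Scott (B : open X) (I : ideal P) (x : P) : is_lsup I x ->
  B x <= \Vee_(z : X) (I z `&` B z).
Proof.
move=> hx; have xr : spec x (r (ideal_filter I)) = \top.
  apply/le_anti; rewrite lex1 -[spec _ _]/(lord (x : P) _) hx.
  apply: wedge_ge => z; rewrite le_himp meetx1 /= spec_alg.
  apply: wedge_ge => A; rewrite le_himp meetC.
  exact: (vee_ub (fun z : X => I z `&` A z)).
apply: le_trans (open_alg_le B (ideal_filter I)).
by have := spec_open B x (r (ideal_filter I)); rewrite xr meetx1.
Qed.

Lemma waybelow_alg (cP : lcomplete P) (x : P) :
  waybelow cP x = filter_lower (eta X x).
Proof.
have sup_x : is_lsup (P := P) (filter_lower (eta X x)) x.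
  by rewrite -{2}(alg_point x); exact: alg_lsup.
apply/funext => y; apply/le_anti/andP; split.
  have := wedge_mp (fun I : ideal P => lord x (lsup cP I)) (fun I => I y)
    (filter_lower_ideal (eta X x)).
  by rewrite /= (lsup_unique (lsupP cP _) sup_x) [X in X `&` _]spec_refl meet1x.
apply: vee_le => A; apply: wedge_ge => I; rewrite le_himp.
(* The open [A] passes from [x] up to the supremum of [I]; Scott openness then finds [z] in both [I]
   and [A], and [y], being below [z], is in [I]. *)
apply: (@le_trans _ _ (A (lsup cP I) `&` lower (P := P) A y)).
  rewrite lexI; apply/andP; split; last le_factor.
  by apply: le_trans (spec_open A x (lsup cP I)); rewrite /= lexI; apply/andP; split; le_factor.
apply: le_trans (leI2 (open_Scott A (lsupP cP I)) (lexx _)) _.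
rewrite vee_meet; apply: vee_le => z.
apply: le_trans (ideal_down I z y); rewrite lexI; apply/andP; split; first le_factor.
by apply: le_trans (wedge_mp (A : P -> L) (@lord _ _ P y) z); le_meets.
Qed.

End Algebra.

Theorem mainTheorem3 (d : Order.disp_t) (L : frameType d) (X : LTop0 L)
  (r : cmap (Phi X) X) (rP : is_Phi_algebra r) :
  continuous_lattice (spec_order X) /\
  forall u : Phi X, is_lsup (P := spec_order X) (filter_lower u) (r u).
Proof.
split; last exact: alg_lsup.
exists (alg_lcomplete rP) => x; rewrite (waybelow_alg rP).
by rewrite (lsup_unique (lsupP _ _) (alg_lsup rP (eta X x))) (alg_point rP).
Qed.
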